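(* For any monic irreducible polynomial $\pi\in\mathbb F_q[x]$, the $K$-binomial coefficients satisfy the inequality $$\left|\binom{k}{m}_K\right|_\pi\le1,\qquad 0\le m\le k.$$
   Context: Let $q$ be a power of a prime. In $\mathbb F_q[x]$ put $[i]=x^{q^i}-x$ ($i\ge1$), $D_i=[i][i-1]^q\cdots[1]^{q^{i-1}}$ ($i\ge1$), $D_0=1$. The $K$-binomial coefficients are the elements of $\mathbb F_q(x)$ $$\binom{k}{m}_K=\frac{D_k}{D_mD_{k-m}^{q^m}},\qquad 0\le m\le k.$$ For a monic irreducible $\pi\in\mathbb F_q[x]$ of degree $\delta$, the absolute value $|\cdot|_\pi$ on $\mathbb F_q(x)$ is defined by $|0|_\pi=0$ and $|t|_\pi=q^{-\delta\nu}$ if $t=\pi^\nu\alpha/\alpha'$ with $\nu\in\mathbb Z$, $\alpha,\alpha'\in\mathbb F_q[x]$ not divisible by $\pi$. *)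

(* Defs.v *)
From mathcomp Require Import all_boot all_order all_algebra all_field.
From mathcomp Require Import generic_quotient.

Set Implicit Arguments.
Unset Strict Implicit.
Unset Printing Implicit Defensive.

Import Order.TTheory GRing.Theory Num.Theory.
Local Open Scope ring_scope.

Notation "x %:F" := (@FracField.tofrac _ x) : ring_scope.

(* F is the field with q elements, where q is written #|F|. *)

Definition bracket (F : finFieldType) (i : nat) : {poly F} :=
  'X ^+ (#|F| ^ i)%N - 'X.

(* The empty product gives carlitzD F 0 = 1. *)
Definition carlitzD (F : finFieldType) (k : nat) : {poly F} :=
  \prod_(1 <= i < k.+1) bracket F i ^+ (#|F| ^ (k - i))%N.

(* Only meaningful for m <= k, because of the truncated subtraction k - m. *)
Definition Kbinomial (F : finFieldType) (k m : nat) : {fraction {poly F}} :=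
  (carlitzD F k)%:F / ((carlitzD F m)%:F * (carlitzD F (k - m))%:F ^+ (#|F| ^ m)%N).

(* The multiplicity of pi in p; it is the intended one when pi is not constant
   and p != 0, since pi ^+ n %| p then forces n < size p. *)
Definition pi_mult (F : finFieldType) (pi p : {poly F}) : nat :=
  (\max_(n < size p | (pi ^+ n %| p)%R) n)%N.

(* The exponent nu of t = pi ^ nu * (a / b), read off an arbitrary
   representative of t; pi_absP below shows that the representative, and the
   choice of a and b, do not matter. *)
Definition pi_val (F : finFieldType) (pi : {poly F}) (t : {fraction {poly F}}) : int :=
  (pi_mult pi \n_(repr t))%:Z - (pi_mult pi \d_(repr t))%:Z.

Definition pi_abs (F : finFieldType) (pi : {poly F}) (t : {fraction {poly F}}) : rat :=
  if t == 0 then 0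
  else (#|F|%:R : rat) ^ (- ((size pi).-1%:Z * pi_val pi t)).

Lemma fracE (R : idomainType) (t : {fraction R}) :
  t = (\n_(repr t))%:F / (\d_(repr t))%:F.
Proof.
have nd : (\d_(repr t))%:F != 0 :> {fraction R}.
  by rewrite tofrac_eq0; exact: denom_ratioP.
apply: (mulIf nd); rewrite mulfVK //.
have [r rE] : exists r, r = repr t by exists (repr t).
rewrite -[t in LHS]reprK -rE.
have nr : \d_r != 0 by exact: denom_ratioP.
unlock FracField.tofrac; rewrite -[LHS]FracField.pi_mul.
apply/eqmodP; rewrite /= FracField.equivfE /FracField.mulf.
by rewrite !numden_Ratio ?mulf_neq0 ?oner_eq0 //= ?mulr1 {2}rE reprK -rE mulrC.
Qed.

Lemma pi_multE (F : finFieldType) (pi a : {poly F}) (n : nat) :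
  irreducible_poly pi -> ~~ (pi %| a) -> pi_mult pi (pi ^+ n * a) = n.
Proof.
move=> [pi_gt1 _] pia.
have pi0 : pi != 0 by rewrite -size_poly_gt0 ltnW.
have a0 : a != 0 by apply: contraNneq pia => ->; rewrite dvdp0.
have sz k : (k < size (pi ^+ k))%N.
  elim: k => [|k IH]; first by rewrite expr0 size_poly1.
  rewrite exprS size_mul ?expf_neq0 //.
  by move: pi_gt1 IH; case: (size pi) => [|[|s]] //= _ /leq_trans; apply; rewrite leq_addl.
have lt : (n < size (pi ^+ n * a)%R)%N.
  apply: leq_trans (sz n) _; apply: dvdp_leq; last exact: dvdp_mulr.
  by rewrite mulf_neq0 ?expf_neq0.
apply/eqP; rewrite eqn_leq; apply/andP; split.
  apply/bigmax_leqP => i; apply: contraTT; rewrite -ltnNge => ni.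
  rewrite -(subnKC ni) addSnnS exprD dvdp_mul2l ?expf_neq0 //.
  by apply: contra pia; apply: dvdp_trans; rewrite exprS dvdp_mulr.
by apply: (@leq_bigmax_cond _ _ (fun i => nat_of_ord i) (Ordinal lt)); rewrite /= dvdp_mulr.
Qed.

Lemma pi_decomp (F : finFieldType) (pi p : {poly F}) :
  irreducible_poly pi -> p != 0 ->
  exists n a, ~~ (pi %| a) /\ p = pi ^+ n * a.
Proof.
move=> [pi_gt1 _].
elim: {p}(size p) {-2}p (leqnn (size p)) => [|s IH] p sp p0.
  by move: p0; rewrite -size_poly_eq0 -leqn0 sp.
case: (boolP (pi %| p)) => [/dvdpP [r rE] | npi]; last first.
  by exists 0, p; rewrite mul1r.
have r0 : r != 0 by apply: contraNneq p0 => r0; rewrite rE r0 mul0r.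
have pi0 : pi != 0 by rewrite -size_poly_gt0 ltnW.
have sr : (size r <= s)%N.
  move: sp; rewrite rE size_mul //; move: pi_gt1.
  by case: (size pi) => [|[|u]] // _; rewrite !addnS /= ltnS; apply: leq_trans; rewrite leq_addr.
have [n [a [pia aE]]] := IH r sr r0.
by exists n.+1, a; split=> //; rewrite rE aE exprSr mulrAC.
Qed.

Lemma irred_ndvdM (F : finFieldType) (pi a b : {poly F}) :
  irreducible_poly pi -> ~~ (pi %| a) -> ~~ (pi %| b) -> ~~ (pi %| a * b).
Proof.
move=> ipi pia pib; have cop : coprimep pi a by rewrite irreducible_poly_coprime.
by rewrite Gauss_dvdpr.
Qed.

Lemma cross_exp (K : fieldType) (p a b c d : K) (nu : int) (i j : nat) :
  p != 0 -> b != 0 -> d != 0 ->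
  p ^ nu * (a / b) = p ^+ i * c / (p ^+ j * d) ->
  p ^ (nu + j%:Z) * (a * d) = p ^ i%:Z * (c * b).
Proof.
move=> p0 b0 d0 /eqP; rewrite mulrA eqr_div ?mulf_neq0 ?expf_neq0 // => /eqP E.
by rewrite expfzDr // -!exprnP [RHS]mulrA -E mulrACA.
Qed.

Lemma neg_exp (K : fieldType) (p a b : K) (n i : nat) :
  p != 0 -> p ^ Negz n * a = p ^ i%:Z * b -> a = p ^+ (n.+1 + i) * b.
Proof.
move=> p0; rewrite NegzE -exprnN -exprnP => E.
by rewrite exprD -mulrA -E mulrA mulfV ?mul1r ?expf_neq0.
Qed.

(* pi_abs has the defining property of the pi-adic absolute value. *)
Lemma pi_absP (F : finFieldType) (pi a b : {poly F}) (nu : int) :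
  irreducible_poly pi -> ~~ (pi %| a) -> ~~ (pi %| b) ->
  pi_abs pi (pi%:F ^ nu * (a%:F / b%:F)) =
    (#|F|%:R : rat) ^ (- ((size pi).-1%:Z * nu)).
Proof.
move=> ipi pia pib.
have [pi_gt1 _] := ipi.
have pi0 : pi != 0 by rewrite -size_poly_gt0 ltnW.
have a0 : a != 0 by apply: contraNneq pia => ->; rewrite dvdp0.
have b0 : b != 0 by apply: contraNneq pib => ->; rewrite dvdp0.
have piF0 : pi%:F != 0 :> {fraction {poly F}} by rewrite tofrac_eq0.
set t := _ * _.
have t0 : t != 0 by rewrite !mulf_neq0 ?invr_eq0 ?tofrac_eq0 ?expfz_neq0.
rewrite /pi_abs (negPf t0); congr (_ ^ (- (_ * _))); rewrite /pi_val.
have d0 : \d_(repr t) != 0 by exact: denom_ratioP.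
have n0 : \n_(repr t) != 0.
  by apply: contraNneq t0 => n0; rewrite (fracE t) n0 tofrac0 mul0r.
have [i [c [pic cE]]] := pi_decomp ipi n0.
have [j [d [pid dE]]] := pi_decomp ipi d0.
have d'0 : d != 0 by apply: contraNneq pid => ->; rewrite dvdp0.
have := fracE t; rewrite {1}/t dE cE !pi_multE // !tofracM !tofracXn => E.
have bF : b%:F != 0 :> {fraction {poly F}} by rewrite tofrac_eq0.
have dF : d%:F != 0 :> {fraction {poly F}} by rewrite tofrac_eq0.
have {}E := cross_exp piF0 bF dF E; move: E; rewrite -!tofracM => E.
have pad := irred_ndvdM ipi pia pid; have pcb := irred_ndvdM ipi pic pib.
case: (lerP 0 (nu + j%:Z)) => [|neg].
  case N : (nu + j%:Z) E => [n|//] E _.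
  move: E; rewrite -!exprnP -!tofracXn -!tofracM => /eqP.
  rewrite tofrac_eq => /eqP /(congr1 (pi_mult pi)); rewrite !pi_multE // => <-.
  by rewrite -N addrK.
case N : (nu + j%:Z) E neg => [//|n] E _; exfalso.
have {}E := neg_exp piF0 E.
move: E; rewrite -tofracXn -tofracM => /eqP; rewrite tofrac_eq => /eqP E.
by move: pad; rewrite E addSn exprS -mulrA dvdp_mulr.
Qed.

Lemma pi_factor (F : finFieldType) (pi : {poly F}) (t : {fraction {poly F}}) :
  irreducible_poly pi -> t != 0 ->
  exists (nu : int) (a b : {poly F}),
    [/\ ~~ (pi %| a), ~~ (pi %| b) & t = pi%:F ^ nu * (a%:F / b%:F)].
Proof.
move=> ipi t0; have [pi_gt1 _] := ipi.
have pi0 : pi != 0 by rewrite -size_poly_gt0 ltnW.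
have piF0 : pi%:F != 0 :> {fraction {poly F}} by rewrite tofrac_eq0.
have d0 : \d_(repr t) != 0 by exact: denom_ratioP.
have n0 : \n_(repr t) != 0.
  by apply: contraNneq t0 => n0; rewrite (fracE t) n0 tofrac0 mul0r.
have [i [c [pic cE]]] := pi_decomp ipi n0.
have [j [d [pid dE]]] := pi_decomp ipi d0.
exists (i%:Z - j%:Z), c, d; split=> //.
by rewrite [LHS]fracE cE dE !tofracM !tofracXn expfzDr // -exprnN -exprnP mulf_div.
Qed.

(* Main.v *)
Require Import Defs.
From mathcomp Require Import all_boot all_order all_algebra all_field.
From mathcomp Require Import all_fingroup all_solvable.

Import Order.TTheory GRing.Theory Num.Theory.
Local Open Scope ring_scope.

(** The K-binomial coefficients are polynomials, and a polynomial has
    pi-adic absolute value at most 1 for every irreducible pi.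

    Integrality follows from a Pascal rule.  Let q = #|F|.  Since raising to
    the power q is additive in characteristic p,
      [m + n] = [m] + [n] ^ (q ^ m)     ([bracketD]),
    and D_k = [k] D_(k-1) ^ q ([carlitzDS]).  Expanding [k] with k = m + n and
    dividing by D_m D_(k-m) ^ (q ^ m) gives
      binom(k, m) = binom(k-1, m-1) ^ q + binom(k-1, m) ^ q * D_m ^ (q - 1),
    so integrality propagates from k - 1 to k.  [dvdp_carlitzD] runs this
    induction in divisibility form, which stays inside the polynomial ring. *)

Lemma expr_card_pow_polyB (F : finFieldType) (n : nat) (a b : {poly F}) :
  (a - b) ^+ (#|F| ^ n) = a ^+ (#|F| ^ n) - b ^+ (#|F| ^ n).
Proof.
have [p p_pr pcharFp] := finPcharP F.
have q_pchar : [pchar {poly F}].-nat (#|F| ^ n)%N.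
  rewrite pnatX (eq_pnat _ (pchar_poly F)) (eq_pnat _ (pcharf_eq pcharFp)).
  by rewrite -cardsT [(_.-nat _)](abelem_pgroup (fin_ring_pchar_abelem pcharFp)).
by rewrite exprDn_pchar // exprNn_pchar.
Qed.

(** Telescoping: X^(q^(m+n)) - X passes through X^(q^m), and
    X^(q^(m+n)) - X^(q^m) is the (q^m)-th power of the n-th bracket. *)
Lemma bracketD (F : finFieldType) (m n : nat) :
  bracket F (m + n) = bracket F m + bracket F n ^+ (#|F| ^ m).
Proof.
by rewrite /bracket expr_card_pow_polyB -exprM -expnD addnC [RHS]addrC subrKA addnC.
Qed.

Lemma bracket_neq0 (F : finFieldType) (i : nat) :
  (0 < i)%N -> bracket F i != 0.
Proof.
move=> i0; rewrite /bracket subr_eq0; apply: contraTneq (ltn_expl i (finNzRing_gt1 F)).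
by move/(congr1 (fun p : {poly F} => size p)); rewrite size_polyXn size_polyX => -[->]; rewrite -leqNgt.
Qed.

Lemma carlitzD0 (F : finFieldType) : carlitzD F 0 = 1.
Proof. by rewrite /carlitzD big_geq. Qed.

Lemma carlitzDS (F : finFieldType) (k : nat) :
  carlitzD F k.+1 = bracket F k.+1 * carlitzD F k ^+ #|F|.
Proof.
rewrite /carlitzD big_nat_recr //= subnn expn0 expr1 mulrC; congr (_ * _).
rewrite -prodrXl; apply: eq_big_nat => i /andP[_ ik].
by rewrite -exprM -expnSr subSn.
Qed.

Lemma carlitzD_neq0 (F : finFieldType) (k : nat) : carlitzD F k != 0.
Proof.
elim: k => [|k IH]; first by rewrite carlitzD0 oner_eq0.
by rewrite carlitzDS mulf_neq0 ?expf_neq0 ?bracket_neq0.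
Qed.

(** The Pascal rule in divisibility form: both summands of
    D_(m+n) = [m] D_(m+n-1)^q + [n]^(q^m) D_(m+n-1)^q are multiples of
    D_m D_n^(q^m), by the cases (m-1, n) and (m, n-1) respectively. *)
Lemma dvdp_carlitzD (F : finFieldType) (m n : nat) :
  carlitzD F m * carlitzD F n ^+ (#|F| ^ m) %| carlitzD F (m + n).
Proof.
elim: m n => [|m IHm] n; first by rewrite carlitzD0 mul1r expn0 expr1.
elim: n => [|n IHn]; first by rewrite carlitzD0 expr1n mulr1 addn0.
have q_gt0 : (0 < #|F|)%N by apply: ltnW; exact: finNzRing_gt1.
rewrite addnS [in X in _ %| X]carlitzDS -addnS bracketD mulrDl; apply: dvdp_add.
- rewrite carlitzDS -mulrA dvdp_mul // addSnnS.
  by rewrite expnSr exprM -exprMn dvdp_exp2r.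
- rewrite [carlitzD F n.+1]carlitzDS exprMn mulrCA dvdp_mul // -exprM mulnC exprM.
  (* D_(m+1) %| D_(m+1)^q: this loses the factor D_(m+1)^(q-1) of the Pascal rule. *)
  apply: dvdp_trans (dvdp_exp2r #|F| IHn); rewrite exprMn dvdp_mul //.
  by rewrite dvdp_exp.
Qed.

Lemma Kbinomial_poly (F : finFieldType) (k m : nat) :
  (m <= k)%N -> exists2 b : {poly F}, b != 0 & Kbinomial F k m = b%:F.
Proof.
move=> le_mk; have := dvdp_carlitzD F m (k - m); rewrite subnKC //.
case/dvdpP=> b Dk; exists b.
  by apply: contraNneq (carlitzD_neq0 F k) => b0; rewrite Dk b0 mul0r.
rewrite /Kbinomial Dk tofracM tofracM tofracXn mulfK //.
by rewrite mulf_neq0 ?expf_neq0 ?tofrac_eq0 ?carlitzD_neq0.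
Qed.

Lemma pi_abs_poly_le1 (F : finFieldType) (pi b : {poly F}) :
  irreducible_poly pi -> b != 0 -> pi_abs pi b%:F <= 1.
Proof.
move=> pi_irr b0; have [n [a [pi_a ->]]] := pi_decomp pi_irr b0.
have pi_1 : ~~ (pi %| 1).
  by case: pi_irr => pi_gt1 _; rewrite dvdp1 neq_ltn pi_gt1 orbT.
have -> : (pi ^+ n * a)%:F = pi%:F ^ n%:Z * (a%:F / 1%:F).
  by rewrite tofracM tofracXn tofrac1 divr1 exprnP.
have q_gt0 : (0 < #|F|)%N by apply: ltnW; exact: finNzRing_gt1.
rewrite pi_absP // -PoszM -exprnN invf_le1 ?exprn_gt0 ?ltr0n //.
by rewrite exprn_ege1 // ler1n.
Qed.

Theorem proposition4 (F : finFieldType) (pi : {poly F})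
    (pi_monic : pi \is monic) (pi_irr : irreducible_poly pi)
    (k m : nat) (hmk : (m <= k)%N) :
  pi_abs pi (Kbinomial F k m) <= 1.
Proof. by have [b b0 ->] := @Kbinomial_poly F k m hmk; exact: pi_abs_poly_le1. Qed.
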